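(* Let $P$ be a graded bounded poset of rank $n$ with an EL-labeling $\lambda:\mathcal{E}(P)\to\Lambda$, and let $t\ge1$. For a word $\sigma=\sigma_1\cdots\sigma_n$ of length $n$ over $\Lambda$ let $e\ell_\lambda(\sigma)$ be the number of maximal chains $c$ of $P$ with $\lambda(c)=\sigma$. Then for every $J\subseteq[n-1]$: (1) $(-1)^{|J|-1}\mu(P_J)=\sum_{\sigma:\ \mathrm{Des}(\sigma)=J} e\ell_\lambda(\sigma)$, and hence $(-1)^{n-2}\mu(P)=\sum_{\sigma:\ \mathrm{Des}(\sigma)=[n-1]} e\ell_\lambda(\sigma)$; (2) $(-1)^{|J|-1}\mu(P^{(t)}_J)=\sum_{(\sigma^1,\ldots,\sigma^t):\ \mathrm{Des}(\sigma^1,\ldots,\sigma^t)=J}\ \prod_{i=1}^t e\ell_\lambda(\sigma^i)$, and hence $(-1)^{n-2}\mu(P^{(t)})=\sum \prod_{i=1}^t e\ell_\lambda(\sigma^i)$, the last sum over all $t$-tuples $(\sigma^1,\ldots,\sigma^t)$ of words of length $n$ over $\Lambda$ having no common ascent. Here all sums range over words of length $n$ over $\Lambda$ (respectively $t$-tuples of such words).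
   Context: An edge labeling $\lambda:\mathcal{E}(P)\to\Lambda$ assigns to each cover relation of $P$ an element of a poset $\Lambda$; a maximal chain $\hat0=x_0\lessdot x_1\lessdot\cdots\lessdot x_n=\hat1$ has label word $\lambda(c)=\lambda(x_0,x_1)\cdots\lambda(x_{n-1},x_n)$. For a word $\sigma=\sigma_1\cdots\sigma_n$, $\mathrm{Asc}(\sigma)=\{i\in[n-1]:\sigma_i<\sigma_{i+1}\text{ in }\Lambda\}$ and $\mathrm{Des}(\sigma)=[n-1]\setminus\mathrm{Asc}(\sigma)$; for a $t$-tuple of words, $\mathrm{Des}(\sigma^1,\ldots,\sigma^t)=[n-1]\setminus\bigcap_i\mathrm{Asc}(\sigma^i)$. $\lambda$ is an EL-labeling if in every interval $[x,y]$ there is a unique maximal chain whose label is strictly increasing, and its label word lexicographically precedes that of every other maximal chain of $[x,y]$. The $t$-fold Segre power $P^{(t)}$ ($t\ge2$) is the induced subposet of $P\times\cdots\times P$ ($t$ factors, componentwise order) of $t$-tuples of elements of equal rank; $P^{(1)}=P$. For a graded bounded poset $Q$ of rank $n$ and $J\subseteq[n-1]$, $Q_J$ is the subposet of elements with rank in $J$ together with $\hat0,\hat1$, and $\mu(Q)=\mu_Q(\hat0,\hat1)$ denotes the Möbius number. *)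

(* Defs.v *)
From HB Require Import structures.
From mathcomp Require Import all_boot all_order all_algebra.
From mathcomp Require Import boolp classical_sets functions cardinality fsbigop.

Set Implicit Arguments.
Unset Strict Implicit.
Unset Printing Implicit Defensive.

Import Order.TTheory GRing.Theory Num.Theory.

Local Open Scope ring_scope.
Local Open Scope order_scope.

Section Mobius.
Context {d : Order.disp_t} (Q : finPOrderType d).

(* The fuel [k] bounds the length of the intervals on which the recursion is
   exact; [#|Q|] is always enough, see [mobiusE]. *)
Fixpoint mobius_rec (k : nat) (x y : Q) : int :=
  if k is k'.+1 then
    if x == y then 1%R
    else (- \sum_(z : Q | (x <= z < y)%O) mobius_rec k' x z)%R
  else 0%R.

Definition mobius (x y : Q) : int := mobius_rec #|Q| x y.

Lemma mobius_rec_stable k l (x y : Q) :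
  (#|[set z : Q | (z <= y)%O]| <= k)%N -> (#|[set z : Q | (z <= y)%O]| <= l)%N ->
  mobius_rec k x y = mobius_rec l x y.
Proof.
have pos z : (0 < #|[set w : Q | (w <= z)%O]|)%N.
  by apply/card_gt0P; exists z; rewrite inE.
elim: k l y => [|k IH] [|l] y hk hl /=.
- by [].
- by have := leq_trans (pos y) hk.
- by have := leq_trans (pos y) hl.
case: eqP => // _; congr (- _)%R; apply: eq_bigr => z /andP[_ zy].
suff h : (#|[set w : Q | (w <= z)%O]| < #|[set w : Q | (w <= y)%O]|)%N.
  by apply: IH; rewrite -ltnS; [exact: leq_trans h hk | exact: leq_trans h hl].
apply: proper_card; apply/properP; split.
  by apply/fintype.subsetP => w; rewrite !inE => wz; exact: le_trans wz (ltW zy).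
by exists y; rewrite !inE ?lexx // lt_geF.
Qed.

Lemma mobiusE (x y : Q) :
  mobius x y = if x == y then 1%R
    else (- \sum_(z : Q | (x <= z < y)%O) mobius x z)%R.
Proof.
have le z : (#|[set w : Q | (w <= z)%O]| <= #|Q|)%N by exact: max_card.
by rewrite /mobius (@mobius_rec_stable #|Q| #|Q|.+1) ?le // ltnW // ltnS le.
Qed.

End Mobius.

Definition mobius_number {d : Order.disp_t} (Q : finTBPOrderType d) : int :=
  mobius (\bot : Q) (\top : Q).

Section Graded.
Context {d : Order.disp_t} (Q : finTBPOrderType d).

Definition covers (x y : Q) : bool :=
  (x < y) && ~~ [exists z : Q, (x < z) && (z < y)].

(* The maximal chain x = x_0 <. x_1 <. ... <. x_k = y of the interval [x, y]
   is represented by the sequence [:: x_1; ...; x_k], without its first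
   element x. *)
Definition maximal_chain (x y : Q) (s : seq Q) : bool :=
  path covers x s && (last x s == y).

Definition graded (n : nat) : Prop :=
  forall s : seq Q, maximal_chain \bot \top s -> size s = n.

(* The length of a longest chain \bot = x_0 < x_1 < ... < x_k = x. *)
Definition rank (x : Q) : nat :=
  (\max_(k < #|Q| | [exists s : k.-tuple Q,
                       path <%O \bot%O s && (last \bot%O s == x)]) k)%N.

End Graded.

Section RankSelection.
Context {d : Order.disp_t} (Q : finTBPOrderType d) (n : nat) (J : {set 'I_n}).

Definition rank_selected (x : Q) : bool :=
  [|| [exists j in J, rank x == j], x == \bot | x == \top].

Record rank_selection :=
  RankSelection { rsval :> Q; rsvalP : rank_selected rsval }.

HB.instance Definition _ := [isSub of rank_selection for rsval].
HB.instance Definition _ := [Finite of rank_selection by <:].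
HB.instance Definition _ :=
  [SubChoice_isSubPOrder of rank_selection by <: with d].

Fact rank_selected_bot : rank_selected \bot.
Proof. by rewrite /rank_selected eqxx orbT. Qed.

Fact rank_selected_top : rank_selected \top.
Proof. by rewrite /rank_selected eqxx !orbT. Qed.

Fact rs_le0x (x : rank_selection) : RankSelection rank_selected_bot <= x.
Proof. exact: le0x. Qed.

Fact rs_lex1 (x : rank_selection) : x <= RankSelection rank_selected_top.
Proof. exact: lex1. Qed.

HB.instance Definition _ := Order.hasBottom.Build d rank_selection rs_le0x.
HB.instance Definition _ := Order.hasTop.Build d rank_selection rs_lex1.

End RankSelection.

Section Segre.
Context {d : Order.disp_t} (P : finTBPOrderType d) (t : nat).

Definition equal_rank (x : t.-tupleprod P) : bool :=
  [forall i : 'I_t, forall j : 'I_t, rank (tnth x i) == rank (tnth x j)].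

Record segre_power := SegrePower { spval :> t.-tupleprod P;
                                   spvalP : equal_rank spval }.

HB.instance Definition _ := [isSub of segre_power for spval].
HB.instance Definition _ := [Finite of segre_power by <:].
HB.instance Definition _ :=
  [SubChoice_isSubPOrder of segre_power by <: with d].

Fact equal_rank_bot : equal_rank \bot.
Proof. by apply/'forall_forallP => i j; rewrite !tnth_mktuple. Qed.

Fact equal_rank_top : equal_rank \top.
Proof. by apply/'forall_forallP => i j; rewrite !tnth_mktuple. Qed.

Fact sp_le0x (x : segre_power) : SegrePower equal_rank_bot <= x.
Proof. exact: le0x. Qed.

Fact sp_lex1 (x : segre_power) : x <= SegrePower equal_rank_top.
Proof. exact: lex1. Qed.

HB.instance Definition _ := Order.hasBottom.Build d segre_power sp_le0x.
HB.instance Definition _ := Order.hasTop.Build d segre_power sp_lex1.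

End Segre.

Section Labeling.
Context {d d' : Order.disp_t} (P : finTBPOrderType d) (L : porderType d').
(* Only the values of [lam] on pairs (x, y) with [covers x y] are ever used. *)
Variable lam : P -> P -> L.

Definition label_word (x : P) (s : seq P) : seq L := pairmap lam x s.

Definition increasing_chain (x : P) (s : seq P) : bool :=
  sorted <%O (label_word x s).

Definition EL_labeling : Prop :=
  forall x y : P, x <= y ->
  exists s : seq P,
    [/\ maximal_chain x y s,
        increasing_chain x s,
        forall s', maximal_chain x y s' -> increasing_chain x s' -> s' = s
      & forall s', maximal_chain x y s' -> s' <> s ->
          (label_word x s : seqlexi L) < label_word x s'].

Definition el (n : nat) (sigma : n.-tuple L) : nat :=
  #|[set c : n.-tuple P | maximal_chain \bot \top c
                          && (label_word \bot c == sigma :> seq L)]%SET|.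

End Labeling.

(* {1, ..., n - 1}, as a subset of 'I_n = {0, ..., n - 1}. *)
Definition interior (n : nat) : {set 'I_n} := [set i : 'I_n | (0 < i)%N]%SET.

Section Words.
Context {d' : Order.disp_t} (L : porderType d') (n : nat).

(* Tuples are indexed from 0, so for 1 <= i <= n - 1 the letters sigma_i and
   sigma_(i+1) are the entries of index i - 1 and i. *)
Definition Asc (sigma : n.-tuple L) : {set 'I_n} :=
  [set i in interior n | tnth sigma (ord_pred i) < tnth sigma i]%SET.

Definition Des (sigma : n.-tuple L) : {set 'I_n} :=
  (interior n :\: Asc sigma)%SET.

Definition common_Asc (t : nat) (s : t.-tuple (n.-tuple L)) : {set 'I_n} :=
  (\bigcap_(i < t) Asc (tnth s i))%SET.

Definition tuple_Des (t : nat) (s : t.-tuple (n.-tuple L)) : {set 'I_n} :=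
  (interior n :\: common_Asc s)%SET.

End Words.

(* Main.v *)
Require Import Defs.
From HB Require Import structures.
From mathcomp Require Import all_boot all_order all_algebra.
From mathcomp Require Import boolp classical_sets functions cardinality fsbigop.

(** Compare the labels of consecutive edges by an arbitrary relation [R]. The
    Segre power is labeled by [t]-tuples of labels, with [R] the strict increase
    in every coordinate; its increasing chains are the [t]-tuples of increasing
    chains of [P]. Both formulas thus become one statement on a graded poset in
    which every interval has a unique [R]-increasing maximal chain.

    For [x] of rank [m] let [g_x D] count the maximal chains of [[0, x]] with
    descent set [D], and let [J_k] be the part of [J] below [k]. By induction,
    [mu(0, x) = - (-1)^|J_m| g_x J_m] in the rank selection. Indeed, let [j] in
    [J] be below [m]. A chain from [0] to some [z < x] of rank [j] with descent
    set [J_j] extends by the increasing chain of [[z, x]] to a chain to [x] with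
    descent set [J_j] or [J_j U {j}], and every such chain arises once. So the
    [g_z J_j] add up to [g_x J_j + g_x (J_j U {j})], and the recursion for [mu]
    telescopes from [g_x set0 = 1] to [g_x J_m]. *)

Set Implicit Arguments.
Unset Strict Implicit.
Unset Printing Implicit Defensive.

Import Order.TTheory GRing.Theory Num.Theory.

Local Open Scope order_scope.

Section MaximalChains.
Context {d : Order.disp_t} {Q : finTBPOrderType d}.
Implicit Types (x y z : Q) (s u : seq Q).

Lemma maximal_chain_last x y s : maximal_chain x y s -> last x s = y.
Proof. by case/andP=> _ /eqP. Qed.

Lemma maximal_chain0 x y : maximal_chain x y [::] = (x == y).
Proof. by []. Qed.

Lemma maximal_chain1 x y : maximal_chain x y [:: y] = covers x y.
Proof. by rewrite /maximal_chain /= eqxx !andbT. Qed.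

Lemma maximal_chain_cons x y z s :
  maximal_chain x y (z :: s) = covers x z && maximal_chain z y s.
Proof. by rewrite /maximal_chain /= andbA. Qed.

Lemma maximal_chain_cat x y s u :
  maximal_chain x y (s ++ u) =
  maximal_chain x (last x s) s && maximal_chain (last x s) y u.
Proof. by rewrite /maximal_chain cat_path last_cat eqxx andbT andbA. Qed.

Lemma cat_maximal_chain x y z s u :
  maximal_chain x y s -> maximal_chain y z u -> maximal_chain x z (s ++ u).
Proof.
by move=> cs cu; rewrite maximal_chain_cat (maximal_chain_last cs) cs.
Qed.

Lemma maximal_chain_lt_path x y s : maximal_chain x y s -> path <%O x s.
Proof. by case/andP=> + _; apply: sub_path => a b /andP[]. Qed.

Lemma maximal_chain_le x y s : maximal_chain x y s -> x <= y.
Proof.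
elim: s x => [|z s IH] x; first by case/andP=> _ /eqP <-.
by rewrite maximal_chain_cons => /andP[/andP[/ltW xz _] /IH]; exact: le_trans.
Qed.

Lemma maximal_chain_exists x y : x <= y -> exists s, maximal_chain x y s.
Proof.
have [k] := ubnP #|[set z | x <= z <= y]|; elim: k => // k IH in x y *.
rewrite ltnS => card_k; rewrite le_eqVlt => /predU1P[<-|xy].
  by exists [::]; rewrite maximal_chain0.
have [cov|] := boolP (covers x y).
  by exists [:: y]; rewrite maximal_chain1.
rewrite /covers xy negbK => /existsP[z /andP[xz zy]].
have IH_sub a b w : x <= a -> a <= b -> b <= y -> x <= w <= y ->
    ~~ (a <= w <= b) -> exists s, maximal_chain a b s.
  move=> xa ab le_by w_in w_out; apply: IH ab; apply: leq_trans card_k.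
  apply/proper_card/properP; split; last by exists w; rewrite inE.
  apply/fintype.subsetP => v; rewrite !inE.
  by move=> /andP[/(le_trans xa)-> /le_trans->].
have [s cs] : exists s, maximal_chain x z s.
  by apply: (IH_sub _ _ y); rewrite ?(lt_geF zy) ?andbF ?lexx ?ltW.
have [u cu] : exists u, maximal_chain z y u.
  by apply: (IH_sub _ _ x); rewrite ?(lt_geF xz) ?lexx ?ltW.
by exists (s ++ u); exact: cat_maximal_chain cu.
Qed.

Lemma covers_exists x y : x < y -> exists2 z, covers x z & z <= y.
Proof.
move=> xy; have [[|z s] cs] := maximal_chain_exists (ltW xy).
  by rewrite -(maximal_chain_last cs) ltxx in xy.
rewrite maximal_chain_cons in cs; case/andP: cs => xz /maximal_chain_le zy.
by exists z.
Qed.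

Lemma lt_path_refinement x u : path <%O x u ->
  exists2 s, maximal_chain x (last x u) s & (size u <= size s)%N.
Proof.
elim: u x => [|z u IH] x /=.
  by exists [::]; rewrite ?maximal_chain0.
case/andP=> xz /IH[s cs le_us]; have [v cv] := maximal_chain_exists (ltW xz).
exists (v ++ s); first exact: cat_maximal_chain cs.
case: v cv => [/maximal_chain_last xE|w v _]; first by rewrite -xE ltxx in xz.
by rewrite size_cat /= ltnS (leq_trans le_us) // leq_addl.
Qed.

End MaximalChains.

Section GradedPosets.
Context {d : Order.disp_t} {Q : finTBPOrderType d} {n : nat}.
Hypothesis gradedQ : graded Q n.
Implicit Types (x y z : Q) (s u : seq Q).

Lemma graded_size x y s u :
  maximal_chain x y s -> maximal_chain x y u -> size s = size u.
Proof.
move=> cs cu; have [a ca] := maximal_chain_exists (le0x x).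
have [b cb] := maximal_chain_exists (lex1 y).
have /gradedQ/eqP := cat_maximal_chain ca (cat_maximal_chain cs cb).
have /gradedQ <- := cat_maximal_chain ca (cat_maximal_chain cu cb).
by rewrite !size_cat eqn_add2l eqn_add2r => /eqP.
Qed.

Lemma rank_maximal_chain x s : maximal_chain \bot x s -> rank x = size s.
Proof.
move=> cs; apply/eqP; rewrite eqn_leq; apply/andP; split.
  apply/bigmax_leqP => k /existsP[u /andP[/lt_path_refinement[v cv le_uv]]].
  move=> /eqP ux; rewrite ux in cv.
  by rewrite (graded_size cs cv) -(size_tuple u).
have size_lt : (size s < #|Q|)%N.
  have /card_uniqP uniq_s : uniq (\bot :: s).
    by apply: (sorted_uniq lt_trans ltxx); exact: maximal_chain_lt_path cs.
  by have := max_card (mem (\bot :: s)); rewrite uniq_s.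
apply: (@leq_bigmax_cond _ _ (@nat_of_ord _) (Ordinal size_lt)).
apply/existsP; exists (in_tuple s).
by rewrite /= (maximal_chain_lt_path cs) (maximal_chain_last cs) /=.
Qed.

Lemma maximal_chain_rank x y s :
  maximal_chain x y s -> rank y = (rank x + size s)%N.
Proof.
move=> cs; have [a ca] := maximal_chain_exists (le0x x).
rewrite (rank_maximal_chain (cat_maximal_chain ca cs)) size_cat.
by rewrite (rank_maximal_chain ca).
Qed.

Lemma rank_bot : rank (\bot : Q) = 0%N.
Proof. by rewrite (@rank_maximal_chain _ [::]) // maximal_chain0. Qed.

Lemma rank_top : rank (\top : Q) = n.
Proof.
have [s cs] := maximal_chain_exists (le0x (\top : Q)).
by rewrite (rank_maximal_chain cs) (gradedQ cs).
Qed.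

Lemma rank_lt x y : x < y -> (rank x < rank y)%N.
Proof.
move=> xy; have [[|z s] cs] := maximal_chain_exists (ltW xy).
  by rewrite -(maximal_chain_last cs) ltxx in xy.
by rewrite (maximal_chain_rank cs) addnS ltnS leq_addr.
Qed.

Lemma rank_le x y : x <= y -> (rank x <= rank y)%N.
Proof. by rewrite le_eqVlt => /predU1P[->|/rank_lt/ltnW]. Qed.

Lemma rank_inj_le x y : x <= y -> rank x = rank y -> x = y.
Proof.
by rewrite le_eqVlt => /predU1P[//|/rank_lt] /[swap] ->; rewrite ltnn.
Qed.

Lemma rank_le_n x : (rank x <= n)%N.
Proof. by rewrite -rank_top rank_le ?lex1. Qed.

Lemma covers_rank x y : covers x y = (x < y) && (rank y == (rank x).+1).
Proof.
apply/idP/andP => [cov|[xy /eqP rankE]].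
  have := cov; rewrite -maximal_chain1 => /maximal_chain_rank->.
  by rewrite addn1 eqxx; case/andP: cov.
rewrite /covers xy; apply/existsPn => z; apply/negP.
by move=> /andP[/rank_lt xz /rank_lt]; rewrite rankE ltnS leqNgt xz.
Qed.

End GradedPosets.

Lemma mobius_iso {d d' : Order.disp_t} {S : finPOrderType d}
    {Q : finPOrderType d'} (f : S -> Q) :
    {mono f : x y / x <= y} -> bijective f ->
  forall x y, mobius (f x) (f y) = mobius x y.
Proof.
move=> f_le f_bij x y; rewrite /mobius -(bij_eq_card f_bij).
elim: #|S| y => //= k IH y; rewrite (bij_eq f_bij).
rewrite (reindex f) /=; last exact: onW_bij.
under eq_bigl => z do rewrite f_le (leW_mono f_le).
by under eq_bigr do rewrite IH.
Qed.

Section InitialSegments.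
Context {n : nat}.
Implicit Types (J : {set 'I_n}) (j : 'I_n).

Definition set_below J k : {set 'I_n} := [set i in J | (i < k)%N].

Lemma set_below0 J : set_below J 0 = finset.set0.
Proof. by apply/setP => i; rewrite !inE andbF. Qed.

Lemma set_below_n J : set_below J n = J.
Proof. by apply/setP => i; rewrite !inE ltn_ord andbT. Qed.

Lemma set_below_below J k m : (k <= m)%N ->
  set_below (set_below J m) k = set_below J k.
Proof.
move=> km; apply/setP => i; rewrite !inE -andbA; congr (_ && _).
by apply/andb_idl => ik; exact: leq_trans km.
Qed.

Lemma set_belowS J j :
  set_below J j.+1 = if j \in J then j |: set_below J j else set_below J j.
Proof.
case: ifP => jJ; apply/setP => i; rewrite !inE ltnS leq_eqVlt val_eqE.
  by case: eqVneq => [->|]; rewrite ?jJ.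
by case: eqVneq => [->|//]; rewrite jJ.
Qed.

Lemma set_below_notin J j : j \notin set_below J j.
Proof. by rewrite inE ltnn andbF. Qed.

Local Open Scope ring_scope.

Lemma alternating_set_below_sum (V : pzRingType) (G : {set 'I_n} -> V) J :
  \sum_(j in J) (-1) ^+ #|set_below J j| *
     (G (set_below J j) + G (j |: set_below J j)) =
  G finset.set0 - (-1) ^+ #|J| * G J.
Proof.
pose h k := - ((-1) ^+ #|set_below J k| * G (set_below J k)).
transitivity (h n - h 0%N); last first.
  by rewrite /h set_below_n set_below0 cards0 mul1r opprK addrC.
rewrite -telescope_sumr // big_mkord big_mkcond; apply: eq_bigr => j _.
rewrite /h set_belowS; case: ifP => _; last by rewrite subrr.
by rewrite cardsU1 set_below_notin exprS mulN1r mulNr !opprK addrC mulrDr.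
Qed.

End InitialSegments.

Section Descents.
Context {d : Order.disp_t} {Q : finTBPOrderType d} {T : Type}.
Variables (lam : Q -> Q -> T) (R : rel T).
Implicit Types (x y z : Q) (s u : seq Q).

Definition R_increasing x s : bool := sorted R (pairmap lam x s).

Definition R_labeling : Prop := forall x y, x <= y ->
  exists! s, maximal_chain x y s && R_increasing x s.

(* On the chain [x = c_0 <. c_1 <. ...], position [i > 0] compares the labels
   of the edges below and above [c_i]. *)
Definition ascent x s i : bool :=
  let c := nth \bot (x :: s) in R (lam (c i.-1) (c i)) (lam (c i) (c i.+1)).

Lemma R_increasingP x s :
  reflect (forall i, (0 < i < size s)%N -> ascent x s i) (R_increasing x s).
Proof.
apply: (iffP (sortedP (lam x x))); rewrite size_pairmap => incr.
  case=> // i /= lt_i; have := incr _ lt_i.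
  by rewrite !(nth_pairmap \bot) // ltnW.
move=> i lt_i; rewrite !(nth_pairmap \bot) //; last exact: ltnW.
exact: (incr i.+1).
Qed.

Lemma ascent_catl x s u i :
  (i < size s)%N -> ascent x (s ++ u) i = ascent x s i.
Proof.
move=> lt_i; rewrite /ascent -cat_cons !nth_cat /= !ltnS lt_i (ltnW lt_i).
by rewrite (leq_trans (leq_pred i) (ltnW lt_i)).
Qed.

Lemma ascent_catr x s u i :
  (0 < i)%N -> ascent x (s ++ u) (size s + i) = ascent (last x s) u i.
Proof.
case: i => // i _; rewrite /ascent !addnS /=.
have nthE k :
    nth \bot (x :: (s ++ u)) (size s + k) = nth \bot (last x s :: u) k.
  case: k => [|k]; last by rewrite addnS /= nth_cat ltnNge leq_addr /= addKn.
  by rewrite addn0 (last_nth \bot) -cat_cons nth_cat /= ltnS leqnn.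
by have := (nthE i, nthE i.+1, nthE i.+2); rewrite !addnS /= => -[[-> ->] ->].
Qed.

Section DescentSets.
Context {n : nat}.
Implicit Types (D : {set 'I_n}) (j : 'I_n).

Definition descents x s : {set 'I_n} :=
  [set i : 'I_n | (0 < i < size s)%N && ~~ ascent x s i].

Lemma descents_eq0 x s : (size s <= n)%N ->
  (descents x s == finset.set0) = R_increasing x s.
Proof.
move=> size_s; apply/eqP/R_increasingP => [/setP des0 i i_s|asc].
  have lt_in : (i < n)%N by case/andP: i_s => _ /leq_trans; apply.
  by have := des0 (Ordinal lt_in); rewrite !inE /= i_s => /negbFE.
by apply/setP => i; rewrite !inE; apply/negP => /andP[/asc ->].
Qed.

Lemma descents_lt_size x s (i : 'I_n) : i \in descents x s -> (i < size s)%N.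
Proof. by rewrite inE => /andP[/andP[]]. Qed.

Lemma mem_descents_catl x s u (i : 'I_n) : (i < size s)%N ->
  (i \in descents x (s ++ u)) = (i \in descents x s).
Proof. by move=> i_s; rewrite !inE size_cat i_s ltn_addr // ascent_catl. Qed.

Lemma mem_descents_catr x s u (i : 'I_n) : (size s < i)%N ->
  (i \in descents x (s ++ u)) =
  (i - size s < size u)%N && ~~ ascent (last x s) u (i - size s).
Proof.
move=> s_i; rewrite inE -{1 2 3}(subnKC (ltnW s_i)) size_cat ltn_add2l.
by rewrite ascent_catr ?subn_gt0 // subnKC ?(ltnW s_i) // (leq_ltn_trans _ s_i).
Qed.

Lemma descents_cat_setD1 x s u j D :
    {in D, forall i : 'I_n, (i < j)%N} ->
    size s = j -> (size (s ++ u) <= n)%N ->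
  (descents x (s ++ u) :\ j == D)%SET =
  (descents x s == D) && R_increasing (last x s) u.
Proof.
move=> D_lt size_s size_su.
have D_ge (i : 'I_n) : (j <= i)%N -> (i \in D) = false.
  by move=> ji; apply: contraTF ji => /D_lt; rewrite -ltnNge.
apply/eqP/andP => [/setP desE|[/eqP desE /R_increasingP asc]].
  split; [apply/eqP/setP => i | apply/R_increasingP => k /andP[k_gt0 k_u]].
    have [ij|ji] := ltnP i j.
      by rewrite -desE in_setD1 -val_eqE ltn_eqF // mem_descents_catl ?size_s.
    rewrite D_ge //; apply: contraTF ji => /descents_lt_size.
    by rewrite size_s -ltnNge.
  have lt_n : (j + k < n)%N.
    by apply: leq_trans size_su; rewrite size_cat size_s ltn_add2l.
  have lt_jk : (j < j + k)%N by rewrite -ltn_subLR ?subnn.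
  have := desE (Ordinal lt_n); rewrite D_ge ?(ltnW lt_jk) // in_setD1.
  rewrite -val_eqE mem_descents_catr size_s // addKn k_u /= gtn_eqF //=.
  by move/negbFE.
apply/setP => i; rewrite in_setD1 -val_eqE.
case: ltngtP => [ij|ji|ij] /=; last by rewrite D_ge ?ij.
  by rewrite mem_descents_catl ?size_s // desE.
rewrite mem_descents_catr size_s // D_ge ?(ltnW ji) //.
by case: ltnP => //= lt_u; rewrite asc // subn_gt0 ji.
Qed.

End DescentSets.
End Descents.

Section SetD1.
Context {I : finType}.
Implicit Types (A D : {set I}) (j : I).

Lemma setD1_eq_in A D j : j \notin D ->
  ((A :\ j == D)%SET && (j \in A)) = (A == j |: D).
Proof.
move=> jD; apply/andP/eqP => [[/eqP <- jA]|->]; first by rewrite finset.setD1K.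
by rewrite setU1K // setU11.
Qed.

Lemma setD1_eq_notin A D j : j \notin D ->
  ((A :\ j == D)%SET && (j \notin A)) = (A == D).
Proof.
have setD1_id (B : {set I}) : j \notin B -> (B :\ j)%SET = B.
  move=> jB; apply/setP => i; rewrite !inE.
  by case: eqP => // ->; rewrite (negbTE jB).
by move=> jD; apply/andP/eqP => [[/eqP <- jA]|->]; rewrite setD1_id.
Qed.

End SetD1.

Section DescentChains.
Context {d : Order.disp_t} {Q : finTBPOrderType d} {T : Type} {n : nat}.
Variables (lam : Q -> Q -> T) (R : rel T).
Implicit Types (x y z : Q) (D : {set 'I_n}) (j : 'I_n).

Definition descent_chains m x D : {set m.-tuple Q} :=
  [set s : m.-tuple Q | maximal_chain \bot x s && (descents lam R \bot s == D)].

Lemma card_descents_setD1 m x j D : j \notin D ->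
  #|[set s : m.-tuple Q |
      maximal_chain \bot x s && (descents lam R \bot s :\ j == D)%SET]| =
  (#|descent_chains m x D| + #|descent_chains m x (j |: D)|)%N.
Proof.
move=> jD; rewrite /descent_chains -!sum1dep_card addnC.
rewrite (bigID (fun s : m.-tuple Q => j \in descents lam R \bot s)) /=.
by congr (_ + _)%N; apply: eq_bigl => s;
  rewrite -andbA ?setD1_eq_in ?setD1_eq_notin.
Qed.

Hypothesis gradedQ : graded Q n.
Hypothesis lamR : R_labeling lam R.

Lemma card_increasing_chains x : #|descent_chains (rank x) x finset.set0| = 1%N.
Proof.
have [u [/andP[cu incr_u] uniq_u]] := lamR (le0x x).
have size_u : size u == rank x by rewrite (rank_maximal_chain gradedQ cu).
rewrite -[RHS](cards1 (Tuple size_u)); apply: eq_card => s.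
have s_n : (size s <= n)%N by rewrite size_tuple (rank_le_n gradedQ).
rewrite finset.in_set finset.in_set1 descents_eq0 //.
by apply/idP/eqP => [/uniq_u us|->]; [exact/val_inj | rewrite cu].
Qed.

Lemma card_descent_chains_through x z j D :
    z <= x -> rank z = j -> {in D, forall i : 'I_n, (i < j)%N} ->
  #|descent_chains j z D| =
  #|[set s : (rank x).-tuple Q |
      [&& maximal_chain \bot x s, (descents lam R \bot s :\ j == D)%SET &
          last \bot (take j s) == z]]|.
Proof.
move=> zx rank_z D_lt; have [u [/andP[cu incr_u] uniq_u]] := lamR zx.
have rank_x := maximal_chain_rank gradedQ cu; rewrite rank_z in rank_x.
have le_n : (j + size u <= n)%N by rewrite -rank_x (rank_le_n gradedQ).
rewrite rank_x.
pose glue (s : j.-tuple Q) : (j + size u).-tuple Q := cat_tuple s (in_tuple u).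
have glue_inj : injective glue.
  move=> s s' /(congr1 val)/eqP.
  by rewrite eqseq_cat ?size_tuple // => /andP[/eqP/val_inj].
rewrite -(card_imset _ glue_inj); apply: eq_card => s; rewrite finset.in_set.
apply/imsetP/and3P => [[a + ->]|[cs des_s /eqP last_z]].
  rewrite finset.in_set /= => /andP[ca des_a].
  rewrite take_size_cat ?descents_cat_setD1 ?size_cat ?size_tuple //.
  by rewrite (maximal_chain_last ca) eqxx des_a (cat_maximal_chain ca).
have size_a : size (take j s) == j by rewrite size_takel // size_tuple leq_addr.
move: cs des_s; rewrite -{1 2}(cat_take_drop j s) maximal_chain_cat last_z.
rewrite descents_cat_setD1 ?cat_take_drop ?(eqP size_a) ?size_tuple // last_z.
case/andP=> ca cb /andP[des_a incr_b].
exists (Tuple size_a); first by rewrite finset.in_set /= ca.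
apply/val_inj; rewrite /= -[LHS](cat_take_drop j s); congr (_ ++ _).
by apply/esym/uniq_u; rewrite cb.
Qed.

Lemma sum_descent_chains x j D :
    (j < rank x)%N -> {in D, forall i : 'I_n, (i < j)%N} ->
  (\sum_(z : Q | (z < x)%O && (rank z == j)) #|descent_chains j z D|)%N =
  (#|descent_chains (rank x) x D| + #|descent_chains (rank x) x (j |: D)|)%N.
Proof.
move=> jx D_lt; have jD : j \notin D by apply/negP => /D_lt; rewrite ltnn.
rewrite -card_descents_setD1 // -sum1_card.
rewrite (partition_big (fun s : (rank x).-tuple Q => last \bot (take j s))
           (fun z => (z < x) && (rank z == j))) => [|s]; last first.
  rewrite finset.in_set -{1}(cat_take_drop j s) maximal_chain_cat.
  move=> /andP[/andP[ca cb] _].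
  have rank_j : rank (last \bot (take j s)) = j.
    by rewrite (rank_maximal_chain gradedQ ca) size_takel // size_tuple ltnW.
  rewrite rank_j eqxx andbT lt_neqAle (maximal_chain_le cb) andbT.
  by apply: contraTneq jx => <-; rewrite rank_j ltnn.
apply: eq_bigr => z /andP[/ltW zx /eqP rank_z].
rewrite (card_descent_chains_through zx rank_z D_lt) -sum1_card.
by apply: eq_bigl => s; rewrite !finset.in_set andbA.
Qed.

Local Open Scope ring_scope.

Definition signed_descent_count (J : {set 'I_n}) x : int :=
  (-1) ^+ #|set_below J (rank x)| *
  #|descent_chains (rank x) x (set_below J (rank x))|%:Z.

Lemma signed_descent_count_rec J x :
  signed_descent_count J x = 1 - \sum_(j in set_below J (rank x))
    \sum_(z : Q | (z < x)%O && (rank z == j)) signed_descent_count J z.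
Proof.
set K := set_below J (rank x); pose G D := #|descent_chains (rank x) x D|%:Z.
transitivity (1 - \sum_(j in K) (-1) ^+ #|set_below K j| *
    (G (set_below K j) + G (j |: set_below K j))).
  rewrite alternating_set_below_sum /G card_increasing_chains.
  by rewrite opprB addrC subrK.
congr (1 - _); apply: eq_bigr => j; rewrite inE => /andP[jJ jx].
rewrite set_below_below ?(ltnW jx) // -PoszD -sum_descent_chains // => [|i].
  rewrite -[Posz _]natz natr_sum mulr_sumr; apply: eq_bigr => z.
  by move=> /andP[_ /eqP rank_z]; rewrite /signed_descent_count rank_z natz.
by rewrite inE => /andP[].
Qed.

End DescentChains.

Section RankSelectionMobius.
Context {d : Order.disp_t} {Q : finTBPOrderType d} {T : Type} {n : nat}.
Variables (lam : Q -> Q -> T) (R : rel T).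
Hypothesis gradedQ : graded Q n.
Hypothesis lamR : R_labeling lam R.

Local Open Scope ring_scope.

Section InteriorRanks.
Variable J : {set 'I_n}.
Hypothesis J_interior : J \subset interior n.
Local Notation S := (rank_selection Q J).

Lemma rank_selected_interiorE (q : Q) : (q < \top)%O ->
  (\bot < q)%O && rank_selected J q = [exists j in J, rank q == j].
Proof.
move=> /lt_eqF q_top.
apply/andP/existsP => [[/gt_eqF q_bot]|[j /andP[jJ /eqP rank_q]]].
  by rewrite /rank_selected q_bot q_top !orbF => /existsP.
have j_gt0 : (0 < j)%N.
  by have := fintype.subsetP J_interior _ jJ; rewrite inE.
split; last by apply/orP; left; apply/existsP; exists j; rewrite jJ rank_q eqxx.
rewrite lt0x; apply: contraTneq j_gt0 => qE.
by rewrite -rank_q qE (rank_bot gradedQ).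
Qed.

Lemma big_rank_selection (V : nmodType) (F : Q -> V) (x : S) :
  \sum_(z : S | (\bot < z < x)%O) F (rsval z) =
  \sum_(j in set_below J (rank (rsval x)))
     \sum_(q : Q | (q < rsval x)%O && (rank q == j)) F q.
Proof.
pose between (q : Q) := [&& \bot < q, q < rsval x & rank_selected J q]%O.
transitivity (\sum_(q | between q) F q).
  rewrite [RHS](reindex_omap (val : S -> Q) insub) => [|q /and3P[_ _ q_sel]] /=.
    by apply: eq_bigl => z; rewrite /between rsvalP valK eqxx !andbT.
  by rewrite insubT.
have qE (q : Q) : (q < rsval x)%O ->
    (\bot < q)%O && rank_selected J q = [exists j in J, rank q == j].
  by move=> qx; exact/rank_selected_interiorE/(lt_le_trans qx)/lex1.
rewrite (exchange_big_dep between).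
  apply: eq_bigr => q /and3P[q_bot qx q_sel].
  have : [exists j in J, rank q == j] by rewrite -qE // q_bot.
  case/existsP=> j /andP[jJ /eqP rank_q]; rewrite (big_pred1 j) // => i.
  rewrite qx inE rank_q /= val_eqE eq_sym.
  case: eqVneq => [->|]; rewrite ?andbF //.
  by rewrite jJ -rank_q (rank_lt gradedQ).
move=> j q; rewrite inE /between => /andP[jJ _] /andP[qx rank_q]; rewrite qx /=.
by rewrite qE //; apply/existsP; exists j; rewrite jJ.
Qed.

Lemma mobius_bot_rank_selection (x : S) : x != \bot ->
  mobius \bot x = - signed_descent_count lam R J (rsval x).
Proof.
have [k] := ubnP (rank (rsval x)); elim: k => // k IH in x *.
rewrite ltnS => x_k x_bot; have bot_x : (\bot < x)%O by rewrite lt0x.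
rewrite mobiusE eq_sym (negbTE x_bot) (bigD1 \bot) ?lexx //= {1}mobiusE eqxx.
rewrite signed_descent_count_rec // -big_rank_selection -sumrN.
congr (- (1 + _)); apply: eq_big => [z|z /andP[/andP[_ zx] z_bot]].
  by rewrite le0x lt0x andbC.
by apply: IH => //; apply: leq_trans x_k; apply: (rank_lt gradedQ).
Qed.

Theorem mobius_number_rank_selection : (0 < n)%N ->
  (-1) ^ (#|J|%:Z - 1) * mobius_number (rank_selection Q J) =
  #|descent_chains lam R n \top J|%:Z.
Proof.
move=> n_gt0; have rank_top := rank_top gradedQ.
have top_bot : (\top : S) != \bot.
  apply: contraTneq n_gt0 => /(congr1 (val : S -> Q))/= top_bot.
  by rewrite -rank_top top_bot (rank_bot gradedQ).
rewrite /mobius_number mobius_bot_rank_selection // /signed_descent_count /=.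
rewrite rank_top set_below_n.
rewrite exprzDr ?unitrN1 // exprN1 invrN1 -exprnP mulrN1 mulrNN mulrA -expr2.
by rewrite sqrr_sign mul1r.
Qed.

End InteriorRanks.

Lemma card_interior : #|interior n| = n.-1.
Proof.
case: n => [|k]; first by apply: eq_card0 => -[].
have := cardsC1 (ord0 : 'I_k.+1); rewrite card_ord => <-.
by apply: eq_card => i; rewrite !inE -val_eqE /= lt0n.
Qed.

Lemma rank_selected_interior (q : Q) : rank_selected (interior n) q.
Proof.
have [->|q_bot] := eqVneq q \bot%O; first exact: rank_selected_bot.
have [->|q_top] := eqVneq q \top%O; first exact: rank_selected_top.
have lt_n : (rank q < n)%N.
  by rewrite -(rank_top gradedQ) (rank_lt gradedQ) ?ltx1.
have gt0 : (0 < rank q)%N.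
  by rewrite -(rank_bot gradedQ) (rank_lt gradedQ) ?lt0x.
by apply/orP; left; apply/existsP; exists (Ordinal lt_n); rewrite inE gt0 /=.
Qed.

Theorem mobius_number_graded : (0 < n)%N ->
  (-1) ^ (n%:Z - 2) * mobius_number Q =
  #|descent_chains lam R n \top (interior n)|%:Z.
Proof.
move=> n_gt0; rewrite -mobius_number_rank_selection // card_interior.
rewrite -{1}(prednK n_gt0) -addn1 PoszD -addrA; congr (_ * _).
have rsval_le : {mono (@rsval _ Q n (interior n)) : x y / (x <= y)%O} by [].
have rsval_bij : bijective (@rsval _ Q n (interior n)).
  exists (fun q => RankSelection (rank_selected_interior q)) => // x.
  exact: val_inj.
exact: (mobius_iso rsval_le rsval_bij \bot%O \top%O).
Qed.

End RankSelectionMobius.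

Section SegrePower.
Context {d : Order.disp_t} {P : finTBPOrderType d} {t n : nat}.
Hypothesis t_gt0 : (0 < t)%N.
Hypothesis gradedP : graded P n.
Local Notation Q := (segre_power P t).
Local Notation i0 := (Ordinal t_gt0).
Implicit Types (x y z : Q) (s : seq Q) (i : 'I_t).

Definition segre_proj i (x : Q) : P := tnth (spval x) i.

Lemma segre_proj_bot i : segre_proj i \bot = \bot.
Proof. by rewrite /segre_proj tnth_mktuple. Qed.

Lemma segre_proj_top i : segre_proj i \top = \top.
Proof. by rewrite /segre_proj tnth_mktuple. Qed.

Lemma segre_proj_inj x y : (forall i, segre_proj i x = segre_proj i y) -> x = y.
Proof. by move=> eq_xy; apply/val_inj/eq_from_tnth. Qed.

Lemma map_segre_proj_inj s s' :
  (forall i, map (segre_proj i) s = map (segre_proj i) s') -> s = s'.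
Proof.
elim: s s' => [|x s IH] [|y s'] eq_s //; try by have := eq_s i0.
congr (_ :: _); first by apply: segre_proj_inj => i; have [] := eq_s i.
by apply: IH => i; have [] := eq_s i.
Qed.

Lemma rank_segre_proj i j x : rank (segre_proj i x) = rank (segre_proj j x).
Proof. by apply/eqP; have /'forall_forallP := spvalP x; apply. Qed.

Lemma segre_exists (f : 'I_t -> P) : (forall i j, rank (f i) = rank (f j)) ->
  exists x, forall i, segre_proj i x = f i.
Proof.
move=> rank_f.
have f_rank : equal_rank ([tuple f i | i < t] : t.-tupleprod P).
  by apply/'forall_forallP => i j; rewrite !tnth_mktuple (rank_f i j).
by exists (SegrePower f_rank) => i; rewrite /segre_proj tnth_mktuple.
Qed.

Lemma segre_leE x y : (x <= y) = [forall i, segre_proj i x <= segre_proj i y].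
Proof. by rewrite -Order.le_val Order.TupleProdOrder.leEtprod. Qed.

Lemma segre_ltE x y : (x < y) = [forall i, segre_proj i x < segre_proj i y].
Proof.
apply/idP/forallP => [xy i|lt_xy]; last first.
  rewrite lt_neqAle segre_leE; apply/andP; split.
    by apply: contraTneq (lt_xy i0) => ->; rewrite ltxx.
  by apply/forallP => i; exact: ltW.
have le_xy j : segre_proj j x <= segre_proj j y.
  by apply/forallP: j; rewrite -segre_leE ltW.
rewrite lt_neqAle le_xy andbT; apply: contraTneq xy => eq_i.
rewrite lt_neqAle negb_and negbK; apply/orP; left.
apply/eqP/segre_proj_inj => j.
by apply: (rank_inj_le gradedP) => //; rewrite !(rank_segre_proj j i) eq_i.
Qed.

Lemma segre_covers_lift x (f : 'I_t -> P) :
    (forall i, covers (segre_proj i x) (f i)) ->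
  exists z, forall i, segre_proj i z = f i.
Proof.
move=> cov; apply: segre_exists => i j; have := cov i; have := cov j.
rewrite !(covers_rank gradedP) => /andP[_ /eqP->] /andP[_ /eqP->].
by rewrite (rank_segre_proj i j).
Qed.

Lemma segre_covers_exists x y : x < y ->
  exists2 z, forall i, covers (segre_proj i x) (segre_proj i z) & z <= y.
Proof.
rewrite segre_ltE => /forallP lt_xy.
have /fin_all_exists2[h cov_h le_h] i := covers_exists (lt_xy i).
have [z zE] := segre_covers_lift cov_h.
by exists z => [i|]; rewrite ?segre_leE ?zE //; apply/forallP => i; rewrite zE.
Qed.

Lemma segre_coversE x y :
  covers x y = [forall i, covers (segre_proj i x) (segre_proj i y)].
Proof.
apply/idP/forallP => [/andP[xy no_between] i|cov].
  have [z cov_z] := segre_covers_exists xy.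
  rewrite le_eqVlt => /predU1P[<-//|zy].
  have /existsP[] := no_between; exists z; rewrite zy andbT segre_ltE.
  by apply/forallP => j; case/andP: (cov_z j).
rewrite /covers segre_ltE; apply/andP; split.
  by apply/forallP => i; case/andP: (cov i).
apply/existsPn => z; rewrite !segre_ltE; apply/negP.
move=> /andP[/forallP/(_ i0) xz /forallP/(_ i0) zy].
by case/andP: (cov i0) => _ /existsPn/(_ (segre_proj i0 z)); rewrite xz zy.
Qed.

Lemma segre_maximal_chainE x y s : maximal_chain x y s =
  [forall i, maximal_chain (segre_proj i x) (segre_proj i y)
               (map (segre_proj i) s)].
Proof.
elim: s x => [|z s IH] x.
  apply/andP/forallP => [[_ /eqP <-] i|eq_xy]; first exact/andP.
  by split=> //; apply/eqP/segre_proj_inj => i; have /andP[_ /eqP] := eq_xy i.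
rewrite maximal_chain_cons segre_coversE IH.
apply/andP/forallP => [[/forallP cov /forallP cs] i|cs].
  by rewrite /= maximal_chain_cons cov cs.
by split; apply/forallP => i; have := cs i;
  rewrite /= maximal_chain_cons => /andP[].
Qed.

Lemma graded_segre_power : graded Q n.
Proof.
move=> s; rewrite segre_maximal_chainE => /forallP/(_ i0).
by rewrite segre_proj_bot segre_proj_top => /gradedP; rewrite size_map.
Qed.

Lemma maximal_chain_segre_exists x y (s_ : 'I_t -> seq P) :
    (forall i, maximal_chain (segre_proj i x) (segre_proj i y) (s_ i)) ->
  exists2 s, maximal_chain x y s & forall i, map (segre_proj i) s = s_ i.
Proof.
move=> cs; have [k size_s] : exists k, forall i, size (s_ i) = k.
  exists (rank (segre_proj i0 y) - rank (segre_proj i0 x))%N => i.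
  rewrite (rank_segre_proj _ i y) (rank_segre_proj _ i x).
  by rewrite (maximal_chain_rank gradedP (cs i)) addKn.
elim: k => [|k IH] in x s_ cs size_s *.
  have s_nil i : s_ i = [::] by exact: size0nil.
  exists [::] => [|i]; last by rewrite s_nil.
  rewrite segre_maximal_chainE; apply/forallP => i.
  by rewrite -[map _ _](s_nil i).
pose h i := head \bot (s_ i).
have s_cons i : s_ i = h i :: behead (s_ i).
  by rewrite /h; case: (s_ i) (size_s i).
have /all_and2[cov cs'] i : covers (segre_proj i x) (h i) /\
    maximal_chain (h i) (segre_proj i y) (behead (s_ i)).
  by apply/andP; rewrite -maximal_chain_cons -s_cons.
have [z zE] := segre_covers_lift cov.
have [i||s cs_z sE] := IH z (fun i => behead (s_ i)).
- by rewrite zE.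
- by move=> i; rewrite size_behead size_s.
exists (z :: s) => [|i]; last by rewrite /= sE zE -s_cons.
rewrite maximal_chain_cons cs_z segre_coversE andbT.
by apply/forallP => i; rewrite zE.
Qed.

Section Labels.
Context {T : Type}.
Variables (lam : P -> P -> T) (R : rel T).

Definition segre_label x y : 'I_t -> T :=
  fun i => lam (segre_proj i x) (segre_proj i y).

Definition coordwise : rel ('I_t -> T) :=
  fun a b => [forall i, R (a i) (b i)].

Lemma ascent_segre x s k : ascent segre_label coordwise x s k =
  [forall i, ascent lam R (segre_proj i x) (map (segre_proj i) s) k].
Proof.
apply: eq_forallb => i; rewrite /ascent -map_cons /segre_label.
have nthE k' : nth \bot (map (segre_proj i) (x :: s)) k' =
    segre_proj i (nth \bot (x :: s) k').
  have [k'_s|s_k'] := ltnP k' (size (x :: s)); first exact: nth_map.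
  by rewrite !nth_default ?size_map // segre_proj_bot.
by rewrite !nthE.
Qed.

Lemma R_increasing_segre x s : R_increasing segre_label coordwise x s =
  [forall i, R_increasing lam R (segre_proj i x) (map (segre_proj i) s)].
Proof.
apply/R_increasingP/forallP => [incr i|incr k k_s].
  apply/R_increasingP => k; rewrite size_map => /incr.
  by rewrite ascent_segre => /forallP/(_ i).
rewrite ascent_segre; apply/forallP => i.
by have /R_increasingP := incr i; apply; rewrite size_map.
Qed.

Lemma R_labeling_segre : R_labeling lam R -> R_labeling segre_label coordwise.
Proof.
move=> lamR x y; rewrite segre_leE => /forallP le_xy.
have /fin_all_exists[s_ s_P] i := lamR _ _ (le_xy i).
have [|s cs sE] := @maximal_chain_segre_exists x y s_.
  by move=> i; have [/andP[]] := s_P i.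
exists s; split=> [|u /andP[cu incr_u]].
  rewrite cs R_increasing_segre; apply/forallP => i; rewrite sE.
  by have [/andP[]] := s_P i.
apply: map_segre_proj_inj => i; rewrite sE; have [_ uniq_i] := s_P i.
apply/uniq_i/andP; split.
  by move: cu; rewrite segre_maximal_chainE => /forallP.
by move: incr_u; rewrite R_increasing_segre => /forallP.
Qed.

Lemma descents_segre s : descents (n := n) segre_label coordwise \bot s =
  (\bigcup_(i < t) descents lam R \bot (map (segre_proj i) s))%SET.
Proof.
apply/setP => k; rewrite inE ascent_segre negb_forall.
apply/andP/finset.bigcupP => [[k_s /existsP[i]]|[i _]].
  by rewrite segre_proj_bot => desc; exists i; rewrite // inE size_map k_s.
rewrite inE size_map => /andP[-> desc]; split=> //.
by apply/existsP; exists i; rewrite segre_proj_bot.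
Qed.

End Labels.
End SegrePower.

Lemma EL_R_labeling {d d' : Order.disp_t} {P : finTBPOrderType d}
    {L : porderType d'} (lam : P -> P -> L) :
  EL_labeling lam -> R_labeling lam <%O.
Proof.
move=> EL x y /EL[s [cs incr_s uniq_s _]]; exists s; split; first exact/andP.
by move=> s' /andP[cs' incr_s']; rewrite (uniq_s s').
Qed.

Section LabelWords.
Context {d d' : Order.disp_t} {P : finTBPOrderType d} {L : porderType d'}.
Context {n : nat}.
Variable lam : P -> P -> L.

Definition label_tuple (c : n.-tuple P) : n.-tuple L :=
  pairmap_tuple lam \bot c.

Lemma Des_label_tuple (c : n.-tuple P) :
  Des (label_tuple c) = descents lam <%O \bot c.
Proof.
apply/setP => i; rewrite !inE size_tuple ltn_ord andbT.
case: (posnP i) => //= i_gt0; rewrite andbT; congr (~~ _).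
have predE : ((i + n).-1 %% n)%N = i.-1.
  by rewrite -(prednK i_gt0) addSn /= modnDr modn_small // prednK // ltnW.
rewrite !(tnth_nth (lam \bot \bot)) /= predE.
rewrite !(nth_pairmap \bot) ?size_tuple ?(leq_ltn_trans (leq_pred i)) //.
by rewrite /ascent; case: (i : nat) i_gt0.
Qed.

Lemma elE sigma : el lam sigma =
  #|[set c : n.-tuple P | maximal_chain \bot \top c & label_tuple c == sigma]|.
Proof. by []. Qed.

Section Segre.
Context {t : nat}.
Hypothesis t_gt0 : (0 < t)%N.
Hypothesis gradedP : graded P n.
Local Notation Q := (segre_power P t).

Definition segre_label_words (c : n.-tuple Q) : t.-tuple (n.-tuple L) :=
  [tuple label_tuple (map_tuple (segre_proj i) c) | i < t].

Lemma tuple_Des_bigcup (s : t.-tuple (n.-tuple L)) :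
  tuple_Des s = (\bigcup_(i < t) Des (tnth s i))%SET.
Proof.
rewrite /tuple_Des /common_Asc finset.setDE finset.setC_bigcap big_distrr /=.
by apply: eq_bigr => i _; rewrite -finset.setDE.
Qed.

Lemma tuple_Des_segre_label_words (c : n.-tuple Q) :
  tuple_Des (segre_label_words c) =
  descents (segre_label lam) (coordwise <%O) \bot c.
Proof.
rewrite tuple_Des_bigcup descents_segre; apply: eq_bigr => i _.
by rewrite tnth_mktuple Des_label_tuple.
Qed.

Lemma card_segre_label_words (s : t.-tuple (n.-tuple L)) :
  #|[set c : n.-tuple Q |
      maximal_chain \bot \top c & segre_label_words c == s]| =
  (\prod_(i < t) el lam (tnth s i))%N.
Proof.
pose chains i :=
  [set c : n.-tuple P | maximal_chain \bot \top c & label_tuple c == tnth s i].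
rewrite (eq_bigr (fun i => #|chains i|)) // -cardsXn.
pose unzip (c : n.-tuple Q) : {dffun forall i : 'I_t, n.-tuple P} :=
  [ffun i => map_tuple (segre_proj i) c].
have unzip_inj : injective unzip.
  move=> c c' /ffunP eq_cc'; apply/val_inj/(map_segre_proj_inj t_gt0) => i.
  by have /(congr1 val) := eq_cc' i; rewrite !ffunE.
rewrite -(card_imset _ unzip_inj); apply: eq_card => f.
apply/imsetP/setXnP => [[c + ->] i|fP].
  rewrite inE (segre_maximal_chainE t_gt0 gradedP).
  move=> /andP[/forallP/(_ i) cc /eqP words_c].
  rewrite inE ffunE -words_c tnth_mktuple eqxx andbT.
  by rewrite -(segre_proj_bot i) -(segre_proj_top i).
have [|c cc cE] := @maximal_chain_segre_exists
    _ P t n t_gt0 gradedP \bot \top (fun i => f i).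
  move=> i; have := fP i.
  by rewrite segre_proj_bot segre_proj_top inE => /andP[].
have size_c : size c == n.
  by rewrite -(size_map (segre_proj (Ordinal t_gt0))) cE size_tuple.
have fE : f = unzip (Tuple size_c).
  by apply/ffunP => i; apply/val_inj; rewrite ffunE /= cE.
exists (Tuple size_c) => //; rewrite inE cc; apply/eqP/eq_from_tnth => i.
by have := fP i; rewrite inE fE ffunE tnth_mktuple => /andP[_ /eqP].
Qed.

End Segre.
End LabelWords.

Local Open Scope classical_set_scope.
Local Open Scope ring_scope.

Lemma fsbig_card_fibers (V : pzSemiRingType) (T : finType) (X : choiceType)
    (g : T -> X) (D : pred T) (A : set X) :
  \sum_(x \in A) (#|[set c | D c & g c == x]%SET|%:R : V) =
  #|[set c | D c & g c \in A]%SET|%:R.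
Proof.
rewrite -[A in LHS]set_mem_set.
rewrite -(@bigfs _ _ _ _ (undup (codom g))) ?undup_uniq //; last first.
  move=> x _ x_g; rewrite eq_card0 // => c; rewrite inE.
  by apply: contraNF x_g => /andP[_ /eqP <-]; rewrite mem_undup codom_f.
under eq_bigr do rewrite -sum1dep_card natr_sum.
rewrite (exchange_big_dep (fun c => D c && (g c \in A))) /=; last first.
  by move=> x c xA /andP[-> /eqP->].
rewrite -sum1dep_card natr_sum; apply: eq_bigr => c /andP[Dc gcA].
rewrite (eq_bigl (pred1 (g c))) => [|x] /=.
  rewrite -big_filter filter_pred1_uniq ?undup_uniq ?mem_undup ?codom_f //.
  exact: big_seq1.
by rewrite Dc eq_sym andbC; case: eqP => //= ->.
Qed.

Section LabelWordSums.
Context {d d' : Order.disp_t} {P : finTBPOrderType d} {L : porderType d'}.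
Context {n : nat}.
Variable lam : P -> P -> L.
Implicit Types J : {set 'I_n}.

Lemma sum_el J :
  \sum_(sigma \in [set w : n.-tuple L | Des w = J]) (el lam sigma)%:Z =
  #|descent_chains lam <%O n \top%O J|%:Z.
Proof.
under eq_fsbigr do rewrite elE -natz.
rewrite fsbig_card_fibers natz; congr Posz; apply: eq_card => c; rewrite !inE.
by congr (_ && _); rewrite -Des_label_tuple; exact/asboolP/eqP.
Qed.

Lemma sum_prod_el t J : (0 < t)%N -> graded P n ->
  \sum_(s \in [set s : t.-tuple (n.-tuple L) | tuple_Des s = J])
    \prod_(i < t) (el lam (tnth s i))%:Z =
  #|descent_chains (segre_label (t := t) lam) (coordwise <%O) n \top%O J|%:Z.
Proof.
move=> t_gt0 gradedP.
under eq_fsbigr => s _.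
  under eq_bigr do rewrite -natz.
  rewrite -natr_prod -(card_segre_label_words lam t_gt0 gradedP); over.
rewrite fsbig_card_fibers natz; congr Posz; apply: eq_card => c; rewrite !inE.
by congr (_ && _); rewrite -tuple_Des_segre_label_words; exact/asboolP/eqP.
Qed.

Lemma tuple_Des_eq_interior t (s : t.-tuple (n.-tuple L)) : (0 < t)%N ->
  tuple_Des s = interior n <-> common_Asc s = finset.set0.
Proof.
move=> t_gt0; have Asc_interior : common_Asc s \subset interior n.
  apply: fintype.subset_trans (finset.bigcap_inf (Ordinal t_gt0) isT) _.
  by apply/fintype.subsetP => i; rewrite inE => /andP[].
rewrite /tuple_Des; split=> [/finset.setDidPl|->]; last exact: finset.setD0.
by rewrite disjoint_sym => /disjoint_setI0; rewrite (finset.setIidPl _).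
Qed.

End LabelWordSums.

Theorem theorem2p7 (d d' : Order.disp_t) (P : finTBPOrderType d)
  (L : porderType d') (n t : nat) (lam : P -> P -> L)
  (n_gt0 : (0 < n)%N) (t_gt0 : (0 < t)%N)
  (gradedP : graded P n) (EL : EL_labeling lam) :
  ((forall J : {set 'I_n}, J \subset interior n ->
      (-1) ^ (#|J|%:Z - 1) * mobius_number (rank_selection P J) =
      \sum_(sigma \in [set w : n.-tuple L | Des w = J]) (el lam sigma)%:Z)
   /\
   (-1) ^ (n%:Z - 2) * mobius_number P =
   \sum_(sigma \in [set w : n.-tuple L | Des w = interior n])
      (el lam sigma)%:Z)
  /\
  ((forall J : {set 'I_n}, J \subset interior n ->
      (-1) ^ (#|J|%:Z - 1) *
        mobius_number (rank_selection (segre_power P t) J) =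
      \sum_(s \in [set s : t.-tuple (n.-tuple L) | tuple_Des s = J])
        \prod_(i < t) (el lam (tnth s i))%:Z)
   /\
   (-1) ^ (n%:Z - 2) * mobius_number (segre_power P t) =
   \sum_(s \in [set s : t.-tuple (n.-tuple L) | common_Asc s = finset.set0])
     \prod_(i < t) (el lam (tnth s i))%:Z).
Proof.
have lamR := EL_R_labeling EL.
have graded_segre := graded_segre_power t_gt0 gradedP.
have segre_lamR := R_labeling_segre t_gt0 gradedP lamR.
split; split=> [J J_interior|].
- by rewrite sum_el (mobius_number_rank_selection gradedP lamR).
- by rewrite sum_el (mobius_number_graded gradedP lamR).
- rewrite sum_prod_el //.
  by rewrite (mobius_number_rank_selection graded_segre segre_lamR).
rewrite (mobius_number_graded graded_segre segre_lamR) // -sum_prod_el //.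
by apply: eq_fsbigl; apply/seteqP; split=> s /tuple_Des_eq_interior; apply.
Qed.
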